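(* Let $k \ge n \ge 1$ be integers. Then the set $\{\mathcal{RS}_{\alpha}(x_1,\ldots,x_k) \mid \alpha \vDash n\}$, where $\alpha$ ranges over all compositions of $n$, is a $\mathbb{Z}$-basis for $QSym_n(x_1,\ldots,x_k)$.
   Context: A composition $\alpha=(\alpha_1,\ldots,\alpha_l)\vDash n$ is a finite sequence of positive integers summing to $n$. Its diagram consists of $l$ rows of left-justified cells, the $i$-th row from the top having $\alpha_i$ cells. Let $m$ be the largest part of $\alpha$. A row-strict composition tableau (RSCT) $F$ of shape $\alpha$ is a filling of the cells of the diagram of $\alpha$ with positive integers such that (1) entries strictly decrease in each row from left to right; (2) entries in the leftmost column weakly increase from top to bottom; (3) (row-strict triple rule) if $\hat F$ denotes the $l\times m$ array obtained from $F$ by adding cells with entry $0$ to the end of each row, and $\hat F(i,j)$ its entry in row $i$, column $j$, then for all $1\le i<j\le l$ and $2\le k\le m$: $\hat F(j,k)>\hat F(i,k)$ implies $\hat F(j,k)\ge \hat F(i,k-1)$. The weight of $F$ is $x^F=\prod_i x_i^{w_i(F)}$, where $w_i(F)$ is the number of times $i$ appears in $F$. The row-strict quasisymmetric Schur function is $\mathcal{RS}_\alpha=\sum_T x^T$, the sum over all RSCTs $T$ of shape $\alpha$; $\mathcal{RS}_\alpha(x_1,\ldots,x_k)$ is obtained by setting $x_i=0$ for $i>k$ (i.e. summing only over RSCTs with entries in $\{1,\ldots,k\}$). A polynomial in $x_1,\ldots,x_k$ is quasisymmetric if for every composition $(\alpha_1,\ldots,\alpha_r)$ with $r \le k$ the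 coefficient of $x_{1}^{\alpha_1}\cdots x_{r}^{\alpha_r}$ equals the coefficient of $x_{i_1}^{\alpha_1}\cdots x_{i_r}^{\alpha_r}$ for all $1\le i_1<\cdots<i_r\le k$. Here $QSym_n(x_1,\ldots,x_k)$ is the $\mathbb{Z}$-module of quasisymmetric polynomials in $x_1,\ldots,x_k$ with integer coefficients that are homogeneous of degree $n$. *)

(* Defs.v *)
From mathcomp Require Import all_boot all_order all_algebra.
From mathcomp Require Export mpoly.

Set Implicit Arguments.
Unset Strict Implicit.
Unset Printing Implicit Defensive.

Import GRing.Theory.

Definition is_composition (n : nat) (a : seq nat) : bool :=
  all (leq 1) a && (sumn a == n).

Definition composition (n : nat) : Type := {a : seq nat | is_composition n a}.

Definition max_part (a : seq nat) : nat := \max_(x <- a) x.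

(* Rows and columns are numbered from 0, row 0 being the top one. *)
Definition cell (a : seq nat) : Type :=
  {c : 'I_(size a) * 'I_(max_part a) | c.2 < nth 0 a c.1}.

Definition row_of a (c : cell a) : 'I_(size a) := (val c).1.
Definition col_of a (c : cell a) : 'I_(max_part a) := (val c).2.

Definition hat a (F : cell a -> nat) (i : 'I_(size a)) (j : 'I_(max_part a)) :
    nat :=
  if insub (i, j) is Some c then F c else 0.

Definition is_RSCT a (F : cell a -> nat) : bool :=
  [&& [forall c : cell a, 0 < F c],
      [forall c : cell a, forall d : cell a,
         (row_of c == row_of d) && (col_of c < col_of d) ==> (F d < F c)],
      [forall c : cell a, forall d : cell a,
         [&& col_of c == 0 :> nat, col_of d == 0 :> nat & row_of c <= row_of d]
           ==> (F c <= F d)]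
    & [forall i : 'I_(size a), forall j : 'I_(size a),
         forall k' : 'I_(max_part a), forall k : 'I_(max_part a),
         (i < j) && (k == k'.+1 :> nat) ==>
         (hat F i k < hat F j k) ==> (hat F i k' <= hat F j k)]].

(* The variable of index i : 'I_k is x_(i+1). *)
Definition weight a (k : nat) (F : cell a -> nat) : 'X_{1..k} :=
  [multinom #|[set c : cell a | F c == i.+1]| | i < k].

(* RS_a(x_1, ..., x_k); since the entries of an RSCT are positive, those of
   the tableaux summed over are in {1, ..., k}. *)
Definition RS (k : nat) (a : seq nat) : {mpoly int[k]} :=
  (\sum_(F : {ffun cell a -> 'I_k.+1} | is_RSCT (fun c => F c : nat))
      'X_[weight k (fun c => F c : nat)])%R.

(* The monomial x_(f 0)^(a_0) ... x_(f (r-1))^(a_(r-1)), where r = size a. *)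
Definition place_mon (k : nat) (a : seq nat) (f : 'I_(size a) -> 'I_k) :
    'X_{1..k} :=
  [multinom \sum_(j < size a | f j == i) nth 0 a j | i < k].

Definition quasisymmetric (k : nat) (p : {mpoly int[k]}) : Prop :=
  forall (a : seq nat) (le_ak : size a <= k) (f : 'I_(size a) -> 'I_k),
    all (leq 1) a -> (forall i j : 'I_(size a), i < j -> f i < f j) ->
    (p@_(place_mon (widen_ord le_ak)) = p@_(place_mon f))%R.

Definition QSym (n k : nat) (p : {mpoly int[k]}) : Prop :=
  quasisymmetric p /\ p \is n.-homog.

Definition is_basis (R : pzRingType) (V : lmodType R) (M : V -> Prop)
    (I : eqType) (e : I -> V) : Prop :=
  [/\ forall i : I, M (e i),
      forall (s : seq I) (c : I -> R), uniq s ->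
        (\sum_(i <- s) c i *: e i = 0)%R -> forall i, i \in s -> c i = 0%R
    & forall v : V, M v ->
        exists (s : seq I) (c : I -> R), v = (\sum_(i <- s) c i *: e i)%R].

(* Main.v *)
Require Import Defs.
From mathcomp Require Import all_boot all_order all_algebra.
From mathcomp Require Import zify.

Set Implicit Arguments.
Unset Strict Implicit.
Unset Printing Implicit Defensive.

Import GRing.Theory.

(** The idea is to find integer linear functionals on quasisymmetric polynomials
that detect zero and against which the row-strict functions are unitriangular.

A row-strict tableau is determined by its standardisation together with its
weight. Read the cells column by column, from left to right, the first column
downwards and every other column upwards, and break ties between equal
entries by this order ([key]). A standard tableau [T] then has a descent at
[v] when [v + 1] is read before [v], and the row-strict tableaux that
standardise to [T] are the weakly increasing relabellings of [T] that increase
strictly at each descent ([coef_RS]). Hence the coefficient of RS_a at the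
monomial whose exponents are the block sizes of {0, ..., n - 1} cut at the set
[S] is the number of standard tableaux of shape [a] with descent set inside
[S] ([coef_RS_cuts]). It depends on the exponents but not on the variables that
carry them, which gives quasisymmetry ([RS_QSym]).

By inclusion-exclusion the alternating sum [signed_coef U] takes on RS_a the
number of standard tableaux whose descent set contains [U]
([signed_coef_RS]). This transformation of coefficients is invertible over the
integers, so a quasisymmetric polynomial killed by all of these functionals
is zero ([signed_coef_eq0], [QSym_eq0]).

For the triangularity let [U] be the complement of [S]: inside every block cut
out by [S] the tableau only has descents. The triple rule then forces the cells
of one block into distinct columns ([block_col_inj]), so the column indices of
a block of size d sum to at least 0 + ... + (d - 1) = C(d, 2). Summing over the
blocks, the sum of C(d, 2) over the block sizes is at most the sum of all column
indices of the diagram, which is the sum of C(a_i, 2) over the parts of [a]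
([choose2_blocks_le]). If the two sums agree, every block occupies an initial
segment of the columns, and the triple rule makes the blocks equal to the rows
([blocks_are_rows]); the block sizes are then [a] itself, and exactly one
tableau is possible ([card_row_blocks]). So the matrix of the functionals on
the RS_a is unitriangular for the order by the sum of C(a_i, 2), and the
RS_a are free ([RS_free]) and spanning ([RS_span]) over the integers. *)

(** * Injective labellings by an initial segment of the integers *)

Lemma card_ord_lt (n b : nat) : b <= n -> #|[set v : 'I_n | v < b]| = b.
Proof.
move=> le_bn.
by rewrite -sum1dep_card -(big_ord_widen _ (fun=> 1) le_bn) sum1_card card_ord.
Qed.

Lemma card_inj_lt (X : finType) (n : nat) (T : X -> 'I_n) (b : nat) :
  injective T -> #|X| = n -> b <= n -> #|[set x | T x < b]| = b.
Proof.
move=> injT cardX le_bn; rewrite -[RHS](card_ord_lt le_bn).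
rewrite -(card_imset _ injT); apply: eq_card => v; rewrite inE.
have /imsetP[x _ ->] : v \in T @: [set: X].
  have /eqP -> : T @: [set: X] == [set: 'I_n].
    by rewrite eqEcard subsetT card_imset // !cardsT card_ord cardX leqnn.
  by rewrite inE.
by rewrite mem_imset // inE.
Qed.

Lemma inj_ord_surj (X : finType) (n : nat) (T : X -> 'I_n) (v : 'I_n) :
  injective T -> #|X| = n -> exists x, T x = v.
Proof.
move=> injT cardX.
have [g gK Kg] : bijective T by apply: inj_card_bij; rewrite // cardX card_ord.
by exists (g v).
Qed.

Lemma card_fibres_lt (X Y : finType) (F : X -> nat) (g : Y -> nat) (j : nat) :
  (forall i, #|[set x | F x == i]| = #|[set y | g y == i]|) ->
  #|[set x | F x < j]| = #|[set y | g y < j]|.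
Proof.
move=> eqFg; elim: j => [|j IHj].
  by rewrite !(eq_card (B := pred0)) ?card0 // => x; rewrite inE.
have split (Z : finType) (h : Z -> nat) :
    #|[set z | h z < j.+1]| = #|[set z | h z < j]| + #|[set z | h z == j]|.
  rewrite -(cardsID [set z | h z < j]) (setIidPr _); last first.
    by apply/subsetP=> z; rewrite !inE; apply: leqW.
  by congr (_ + _); apply: eq_card => z; rewrite !inE ltnS -leqNgt eqn_leq andbC.
by rewrite !split IHj eqFg.
Qed.

(** Both [F] and [g] are weakly increasing for the order given by [T], and a weakly
increasing labelling is determined by the sizes of its fibres. This recovers a
tableau from its standardisation and its weight. *)
Lemma sorted_fibres (X : finType) (n : nat) (T : X -> 'I_n) (F : X -> nat)
    (g : 'I_n -> nat) (x : X) :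
    injective T -> #|X| = n -> (forall y z, F y < F z -> T y < T z) ->
    (forall u v : 'I_n, u <= v -> g u <= g v) ->
    (forall i, #|[set x | F x == i]| = #|[set v | g v == i]|) ->
  g (T x) = F x.
Proof.
move=> injT cardX monoT mono_g eqFg.
have cardT b := card_inj_lt injT cardX (b := b).
apply/eqP; rewrite eqn_leq; apply/andP; split; rewrite leqNgt; apply/negP => lt.
- suff: T x < T x by rewrite ltnn.
  have leT : #|[set y | F y < (F x).+1]| <= T x.
    rewrite (card_fibres_lt _ eqFg) -[leqRHS](@card_ord_lt n); last exact: ltnW.
    apply/subset_leq_card/subsetP => v; rewrite !inE ltnS => le_v.
    by rewrite ltnNge; apply/negP => /mono_g; rewrite leqNgt (leq_ltn_trans le_v).
  apply: leq_trans leT; rewrite -[leqLHS](cardT _ (ltn_ord (T x))).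
  apply/subset_leq_card/subsetP => y; rewrite !inE !ltnS => le_y.
  by rewrite leqNgt; apply/negP => /monoT; rewrite ltnNge le_y.
- suff: T x < T x by rewrite ltnn.
  have leT : #|[set y | F y < F x]| <= T x.
    rewrite -[leqRHS](cardT (T x)); last exact: ltnW.
    by apply/subset_leq_card/subsetP => y; rewrite !inE; apply: monoT.
  apply: leq_trans leT; rewrite (card_fibres_lt _ eqFg).
  rewrite -[leqLHS](card_ord_lt (ltn_ord (T x))).
  apply/subset_leq_card/subsetP => v; rewrite !inE ltnS => /mono_g le_v.
  exact: leq_ltn_trans lt.
Qed.

(** An injective labelling by all of {0, ..., n - 1} is determined by the order that it
puts on [X]; an inclusion of two strict total orders is an equality. *)
Lemma order_unique (X : finType) (n : nat) (T T' : X -> 'I_n) :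
    injective T -> injective T' -> #|X| = n ->
    (forall y z, T' y < T' z -> T y < T z) ->
  T =1 T'.
Proof.
move=> injT injT' cardX mono x; apply: val_inj => /=.
apply: (sorted_fibres (F := fun y => T' y : nat) (g := fun v => v : nat) x injT cardX) => // i.
rewrite -(card_imset _ injT'); apply: eq_card => v.
by have [y <-] := inj_ord_surj v injT' cardX; rewrite mem_imset // !inE.
Qed.

(** A property of consecutive labels spreads along a block of [g] by transitivity:
as [g] is weakly increasing, the whole interval between two labels of a
block lies in that block. *)
Lemma ord_chain (X : finType) (n : nat) (T : X -> 'I_n) (g : 'I_n -> nat)
    (r : rel X) (x y : X) :
    injective T -> #|X| = n -> (forall u v : 'I_n, u <= v -> g u <= g v) ->
    transitive r ->
    (forall x y, T y = (T x).+1 :> nat -> g (T x) = g (T y) -> r x y) ->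
  T x < T y -> g (T x) = g (T y) -> r x y.
Proof.
move=> injT cardX mono_g r_trans step.
move: {2}(T y - (T x).+1) (erefl (T y - (T x).+1)) => d.
elim: d x => [|d IHd] x def_d lt_xy eq_g; first by apply: step => //; lia.
have lt_x1 : (T x).+1 < n by apply: leq_ltn_trans (ltn_ord (T y)); lia.
have [z Tz] := inj_ord_surj (Ordinal lt_x1) injT cardX.
have {}Tz : T z = (T x).+1 :> nat by rewrite Tz.
have le_xz : g (T x) <= g (T z) by apply: mono_g; lia.
have le_zy : g (T z) <= g (T y) by apply: mono_g; lia.
have eq_xz : g (T x) = g (T z) by lia.
apply: (r_trans z); first exact: step.
by apply: IHd; lia.
Qed.

Definition lex (X : finType) (u v : X -> nat) (x y : X) : bool :=
  (u x < u y) || (u x == u y) && (v x < v y).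

Definition lex_rank (X : finType) (u v : X -> nat) (x : X) : nat :=
  #|[set y | lex u v y x]|.

Lemma lex_rank_ltn (X : finType) (u v : X -> nat) (x : X) :
  lex_rank u v x < #|X|.
Proof.
rewrite -cardsT; apply/proper_card/properP; split; first exact: subsetT.
by exists x; rewrite !inE // /lex !ltnn andbF.
Qed.

Lemma lex_rank_mono (X : finType) (u v : X -> nat) (x y : X) :
  lex u v x y -> lex_rank u v x < lex_rank u v y.
Proof.
move=> lt_xy; apply/proper_card/properP; split.
  by apply/subsetP => z; rewrite !inE; move: lt_xy; rewrite /lex; lia.
by exists x; rewrite !inE // /lex; lia.
Qed.

(** The position of [x] when [X] is sorted by [u], with ties broken by [v]: with [u] the
entries of a tableau and [v] the reading order this is standardisation. *)
Definition lex_ord (X : finType) (n : nat) (cardX : #|X| = n) (u v : X -> nat)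
    (x : X) : 'I_n :=
  cast_ord cardX (Ordinal (lex_rank_ltn u v x)).

Lemma lex_ord_ltn (X : finType) (n : nat) (cardX : #|X| = n) (u v : X -> nat)
    (x y : X) :
    (forall x y, u x = u y -> v x = v y -> x = y) ->
  (lex_ord cardX u v x < lex_ord cardX u v y) = lex u v x y.
Proof.
move=> injuv; apply/idP/idP; last exact: lex_rank_mono.
rewrite ltnNge; apply: contraNT => nlt_xy; rewrite leq_eqVlt.
case lt_yx: (lex u v y x); first by rewrite orbC; apply/orP; left; apply: lex_rank_mono.
have -> : y = x by apply: injuv; move: nlt_xy lt_yx; rewrite /lex; lia.
by rewrite eqxx.
Qed.

Lemma lex_ord_inj (X : finType) (n : nat) (cardX : #|X| = n) (u v : X -> nat) :
    (forall x y, u x = u y -> v x = v y -> x = y) ->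
  injective (lex_ord cardX u v).
Proof.
move=> injuv x y eq_xy.
have := lex_ord_ltn cardX x y injuv; have := lex_ord_ltn cardX y x injuv.
by rewrite eq_xy ltnn /lex => lt_yx lt_xy; apply: injuv; lia.
Qed.

(** With values 0 and 1, [P] is the indicator of a set of naturals below [m], of size
d say. Its d distinct elements sum to at least 0 + ... + (d - 1), with equality
only for an initial segment, that is a set closed under taking smaller elements. *)
Lemma sum_distinct_ge (P : nat -> nat) (m : nat) :
    (forall i, i < m -> P i <= 1) ->
  'C(\sum_(i < m) P i, 2) <= \sum_(i < m) P i * i /\
  ('C(\sum_(i < m) P i, 2) = \sum_(i < m) P i * i ->
   forall i j, j < i < m -> 0 < P i -> 0 < P j).
Proof.
elim: m => [|m IHm] P_le1; first by rewrite !big_ord0; split=> // _ i j; rewrite ltn0 andbF.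
have [|IHge IHeq] := IHm; first by move=> i /ltnW; apply: P_le1.
have le_m : \sum_(i < m) P i <= m ?= iff [forall i : 'I_m, 0 < P i].
  have leif i (_ : true) : P (nat_of_ord (i : 'I_m)) <= 1 ?= iff (0 < P i).
    split; first by apply: P_le1; have := ltn_ord i; lia.
    by have := P_le1 i; have := ltn_ord i; lia.
  have := leqif_sum leif; rewrite sum_nat_const card_ord muln1; congr (_ <= _ ?= iff _).
rewrite !big_ord_recr /=.
have := P_le1 m (ltnSn m); case Pm: (P m) => [|[|//]] _.
  rewrite !mul0n !addn0; split=> // /IHeq closed i j /andP[lt_ji].
  rewrite ltnS leq_eqVlt => /predU1P[->|lt_im]; first by rewrite Pm.
  by apply: closed; rewrite lt_ji.
rewrite addn1 binS bin1 mul1n; split; first exact: leq_add IHge le_m.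
move=> eq_sum i j /andP[lt_ji lt_im] _.
have /eqP : \sum_(i < m) P i = m.
  by apply/eqP; rewrite eqn_leq le_m.1 -(leq_add2l ('C(\sum_(i < m) P i, 2))) eq_sum leq_add2r.
rewrite le_m => /forallP all_pos; have lt_jm : j < m by lia.
exact: (all_pos (Ordinal lt_jm)).
Qed.

(** * Cells, tableaux and the reading order *)

Section Cells.
Variable a : seq nat.
Implicit Types c d e : cell a.

Lemma cell_eq c d : row_of c = row_of d :> nat -> col_of c = col_of d :> nat -> c = d.
Proof.
move=> /ord_inj eq_row /ord_inj eq_col; apply: val_inj.
by rewrite [LHS]surjective_pairing [RHS]surjective_pairing; congr (_, _).
Qed.

Lemma nth_le_max_part i : nth 0 a i <= max_part a.
Proof.
case: (ltnP i (size a)) => [lt_i|le_i]; last by rewrite nth_default.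
exact: (leq_bigmax_seq (P := xpredT) (F := id) (nth 0 a i) (mem_nth 0 lt_i)).
Qed.

Lemma cell_exists i j : i < size a -> j < nth 0 a i ->
  exists c, row_of c = i :> nat /\ col_of c = j :> nat.
Proof.
move=> lt_i lt_j; have lt_jm := leq_trans lt_j (nth_le_max_part i).
by exists (Sub (Ordinal lt_i, Ordinal lt_jm) lt_j); rewrite /row_of /col_of SubK.
Qed.

Lemma col_lt c : col_of c < nth 0 a (row_of c).
Proof. exact: (valP c). Qed.

Lemma sum_cells (F : nat -> nat -> nat) :
  \sum_(c : cell a) F (row_of c) (col_of c) =
  \sum_(i < size a) \sum_(j < nth 0 a i) F i j.
Proof.
rewrite -(big_sub [pred p : 'I_(size a) * 'I_(max_part a) | p.2 < nth 0 a p.1]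
  (fun p => F p.1 p.2)).
rewrite (eq_bigl (fun p : 'I_(size a) * 'I_(max_part a) => true && (p.2 < nth 0 a p.1))) //.
rewrite -(pair_big_dep xpredT (fun (i : 'I_(size a)) (j : 'I_(max_part a)) => j < nth 0 a i)
  (fun i j => F i j)) /=.
by apply: eq_bigr => i _; rewrite -(big_ord_widen _ (F i) (nth_le_max_part i)).
Qed.

Lemma card_cells : #|{: cell a}| = sumn a.
Proof.
rewrite -sum1_card (sum_cells (fun _ _ => 1)) sumnE (big_nth 0) big_mkord.
by apply: eq_bigr => i _; rewrite sum1_card card_ord.
Qed.

Lemma card_row i : #|[set c : cell a | row_of c == i :> nat]| = nth 0 a i.
Proof.
rewrite -sum1dep_card big_mkcond (sum_cells (fun r _ => if r == i then 1 else 0)).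
case: (ltnP i (size a)) => [lt_i|le_i].
  rewrite (bigD1 (Ordinal lt_i)) //= eqxx sum1_card card_ord big1 ?addn0 //.
  by move=> j; rewrite -val_eqE /= => /negbTE->; apply: big1_eq.
rewrite nth_default // big1 // => j _; rewrite ltn_eqF ?big1_eq //.
exact: leq_trans le_i.
Qed.

(** The last condition is the triple rule without the padding by zeros: the
hypothesis on [e] says that the cell to the right of [c], if there is one, has a
smaller entry than [d]; entries are positive, so an absent cell always does. *)
Lemma RSCTP (F : cell a -> nat) : is_RSCT F <->
  [/\ forall c, 0 < F c,
      forall c d, row_of c = row_of d :> nat -> col_of c < col_of d -> F d < F c,
      forall c d, col_of c = 0 :> nat -> col_of d = 0 :> nat ->
        row_of c <= row_of d -> F c <= F d
    & forall c d, row_of c < row_of d -> col_of d = (col_of c).+1 :> nat ->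
        (forall e, row_of e = row_of c :> nat -> col_of e = col_of d :> nat ->
           F e < F d) -> F c <= F d].
Proof.
split=> [/and4P[pos rows col0 triple]|[pos rows col0 triple]].
  split=> [c|c d /ord_inj eq_r lt_c|c d c0 d0 le_r|c d lt_r eq_c above].
  - exact: (forallP pos).
  - by have /forallP/(_ d)/implyP := forallP rows c; apply; rewrite eq_r eqxx.
  - by have /forallP/(_ d)/implyP := forallP col0 c; apply; rewrite c0 d0 le_r.
  have /forallP/(_ (row_of d))/forallP/(_ (col_of c))/forallP/(_ (col_of d)) :=
    forallP triple (row_of c).
  rewrite lt_r eq_c eqxx /= /hat -!surjective_pairing !valK.
  case: insubP => [e _ val_e|_]; last by rewrite (forallP pos d).
  by rewrite above // /row_of /col_of val_e.
apply/and4P; split.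
- by apply/forallP.
- apply/forallP => c; apply/forallP => d; apply/implyP => /andP[/eqP eq_r lt_c].
  by apply: rows; rewrite ?eq_r.
- apply/forallP => c; apply/forallP => d; apply/implyP => /and3P[/eqP c0 /eqP d0 le_r].
  exact: col0.
apply/forallP => i; apply/forallP => j; apply/forallP => k'; apply/forallP => k.
apply/implyP => /andP[lt_ij /eqP eq_k]; apply/implyP; rewrite /hat.
case: (insubP _ (j, k)) => [d _ val_d|//].
case: (insubP _ (i, k')) => [c _ val_c|//] lt_hat.
apply: triple; rewrite /row_of /col_of val_c val_d //= => e re ce.
suff val_e : val e = (i, k) by rewrite -val_e valK in lt_hat.
by rewrite [LHS]surjective_pairing; congr (_, _); apply: ord_inj.
Qed.

Lemma eq_RSCT (F G : cell a -> nat) : F =1 G -> is_RSCT F -> is_RSCT G.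
Proof.
move=> eqFG /RSCTP[pos rows col0 triple]; apply/RSCTP.
split=> [c|c d|c d|c d lt_r eq_c above]; rewrite -?eqFG; [exact: pos|exact: rows|exact: col0|].
by apply: triple => // e re ce; rewrite !eqFG; apply: above.
Qed.

(** The reading order, which breaks ties between equal entries in a standardisation.
The first column has to be read downwards, since its entries weakly increase.
The others have to be read upwards: if equal entries in one of them were split in
the other direction, the lower one would become larger than the upper one, and
the triple rule would ask it to be at least the left neighbour of the upper one,
which it is not. *)
Definition key c : nat :=
  col_of c * size a +
  (if col_of c == 0 :> nat then row_of c : nat else size a - row_of c).

Lemma key_col c d : col_of c < col_of d -> key c < key d.
Proof.
rewrite /key => lt_cd; have lt_rc := ltn_ord (row_of c); have lt_rd := ltn_ord (row_of d).
have := leq_mul2r (size a) (col_of c).+1 (col_of d); rewrite lt_cd orbT mulSn.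
by case: eqP; case: eqP; lia.
Qed.

Lemma key_col0 c d : col_of c = 0 :> nat -> col_of d = 0 :> nat ->
  row_of c < row_of d -> key c < key d.
Proof. by rewrite /key => -> ->. Qed.

Lemma key_colS c d : col_of c = col_of d :> nat -> 0 < col_of c ->
  row_of c < row_of d -> key d < key c.
Proof.
rewrite /key => <- /lt0n_neq0/negbTE-> lt_r; have := ltn_ord (row_of d); lia.
Qed.

Lemma key_inj : injective key.
Proof.
move=> c d eq_key.
have eq_c : col_of c = col_of d :> nat.
  by case: (ltngtP (col_of c) (col_of d)) => // /key_col; lia.
apply: cell_eq => //; move: eq_key; rewrite /key eq_c.
have := ltn_ord (row_of c); have := ltn_ord (row_of d); case: eqP; lia.
Qed.

End Cells.

(** * Standardisation *)

(** When [a] has [n] cells, injectivity makes the entries exactly 1, ..., n. *)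
Definition standard (a : seq nat) (n : nat) : {set {ffun cell a -> 'I_n}} :=
  [set T : {ffun cell a -> 'I_n} | injectiveb T && is_RSCT (fun c => (T c).+1)].

(** The condition on a weakly increasing [g] under which merging the entries of [T]
along [g] loses nothing: two consecutive entries of [T] may receive the same
value only if the reading order can tell which of them was smaller. *)
Definition rises_at_descents (a : seq nat) (n : nat) (g : 'I_n -> nat)
    (T : cell a -> 'I_n) : bool :=
  [forall c, forall d,
     (T d == (T c).+1 :> nat) && (key d < key c) ==> (g (T c) < g (T d))].

(** The weight of a standard tableau relabelled by [g], up to the shift by one. *)
Definition fibre_mon (k n : nat) (g : 'I_n -> nat) : 'X_{1..k} :=
  [multinom #|[set v | g v == i]| | i < k].

Lemma risesP (a : seq nat) (n : nat) (g : 'I_n -> nat) (T : cell a -> 'I_n) :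
  reflect (forall c d, T d = (T c).+1 :> nat -> key d < key c -> g (T c) < g (T d))
    (rises_at_descents g T).
Proof.
apply: (iffP 'forall_forallP) => [rises c d eq_T lt_key|rises c d].
  by have /implyP := rises c d; apply; rewrite eq_T eqxx.
by apply/implyP => /andP[/eqP]; apply: rises.
Qed.

Section Standardisation.
Variables (a : seq nat) (n : nat).
Hypothesis size_a : sumn a = n.

Let card_n : #|{: cell a}| = n.
Proof. by rewrite card_cells. Qed.

Lemma standardP (T : {ffun cell a -> 'I_n}) :
  reflect (injective T /\ is_RSCT (fun c => (T c).+1)) (T \in standard a n).
Proof.
by rewrite inE; apply: (iffP andP) => -[/injectiveP].
Qed.

Lemma key_ltn_in_block (T : cell a -> 'I_n) (g : 'I_n -> nat) c d :
    injective T -> (forall u v : 'I_n, u <= v -> g u <= g v) ->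
    rises_at_descents g T ->
  T c < T d -> g (T c) = g (T d) -> key c < key d.
Proof.
move=> injT mono_g /risesP rises; apply: (ord_chain (r := [rel x y | key x < key y])) => //.
  by move=> y x z; apply: ltn_trans.
move=> x y eq_T eq_g /=; case: (ltngtP (key x) (key y)) => // [lt|/key_inj eq_xy].
  by have := rises x y eq_T lt; rewrite eq_g ltnn.
by move: eq_T; rewrite eq_xy; lia.
Qed.

(** Inside a block the entries of [T] increase along the reading order, whereas in a
row the smaller of two entries lies further right and is read later; so no two
entries of a row are merged. *)
Lemma collapse_RSCT (T : {ffun cell a -> 'I_n}) (g : 'I_n -> nat) :
    T \in standard a n -> (forall u v : 'I_n, u <= v -> g u <= g v) ->
    rises_at_descents g T ->
  is_RSCT (fun c => (g (T c)).+1).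
Proof.
case/standardP => injT /RSCTP[_ rows col0 triple] mono_g rises.
apply/RSCTP; split=> [//|c d eq_r lt_c|c d c0 d0 le_r|c d lt_r eq_c above]; rewrite ltnS.
- have lt_T := rows _ _ eq_r lt_c.
  rewrite ltn_neqAle mono_g ?andbT; last exact: ltnW.
  apply/eqP => /(key_ltn_in_block injT mono_g rises lt_T).
  by rewrite ltnNge (ltnW (key_col lt_c)).
- by apply: (mono_g _ _); apply: (col0 c d).
apply: (mono_g _ _); apply: (triple c d) => // e re ce.
by move: (above e re ce); rewrite !ltnS !ltnNge; apply: contra => /mono_g.
Qed.

Lemma lex_key_inj (F : cell a -> nat) c d : F c = F d -> key c = key d -> c = d.
Proof. by move=> _ /key_inj. Qed.

(** Only ties need care. In a row there are none, and in the first column the reading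
order agrees with the order required. In the triple rule, [c] is read before [d];
if the cell [e] right of [c] ties with [d], it is read after [d] because
it is higher in a column read upwards, so it cannot be below [d] in the
standardisation and the rule for [F] applies. *)
Lemma standardise_standard (F : cell a -> nat) : is_RSCT F ->
  [ffun c => lex_ord card_n F (@key a) c] \in standard a n.
Proof.
have lt_lex := lex_ord_ltn card_n _ _ (@lex_key_inj F).
case/RSCTP => [_ rows col0 triple]; apply/standardP; split.
  by move=> c d; rewrite !ffunE; apply: (lex_ord_inj (@lex_key_inj F)).
apply/RSCTP; split=> [//|c d eq_r lt_c|c d c0 d0 le_r|c d lt_r eq_c above]; rewrite !ffunE ltnS.
- by rewrite lt_lex /lex rows.
- rewrite leqNgt lt_lex /lex; have := col0 c d c0 d0 le_r.
  move: le_r; rewrite leq_eqVlt => /predU1P[eq_r|lt_r].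
    have -> : c = d by apply: cell_eq; rewrite ?c0.
    by rewrite !ltnn andbF.
  by have := key_col0 c0 d0 lt_r; lia.
have lt_key : key c < key d by apply: key_col; rewrite eq_c.
rewrite leqNgt lt_lex /lex; suff: F c <= F d by lia.
apply: triple => // e re ce; have := above e re ce.
rewrite !ffunE ltnS lt_lex /lex => /orP[//|/andP[_]].
by rewrite ltnNge ltnW // key_colS ?ce ?re ?eq_c.
Qed.

(** Relabelling by [g] and standardising are mutually inverse between the standard
tableaux that rise at their descents and the tableaux whose weight is the
monomial of [g]. *)
Lemma coef_RS (k : nat) (g : 'I_n -> nat) :
    (forall u v : 'I_n, u <= v -> g u <= g v) -> (forall v, g v < k) ->
  ((RS k a)@_(fibre_mon k g) =
   #|[set T in standard a n | rises_at_descents g T]|%:R)%R.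
Proof.
move=> mono_g g_lt.
pose m := fibre_mon k g.
pose content_m := [set F : {ffun cell a -> 'I_k.+1} |
  is_RSCT (fun c => F c : nat) && (weight k (fun c => F c : nat) == m)].
pose collapse (T : {ffun cell a -> 'I_n}) : {ffun cell a -> 'I_k.+1} :=
  [ffun c => inord (g (T c)).+1].
have val_collapse T c : collapse T c = (g (T c)).+1 :> nat.
  by rewrite ffunE inordK // ltnS.
have -> : ((RS k a)@_m = #|content_m|%:R)%R.
  rewrite /RS raddf_sum /= -sum1dep_card natr_sum [RHS]big_mkcondr /=.
  by apply: eq_bigr => F _; rewrite mcoeffX; case: eqP.
set B := [set T in _ | _]; congr (_ %:R)%R.
have fibre_T (T : cell a -> 'I_n) i : injective T ->
    #|[set c | g (T c) == i]| = #|[set v | g v == i]|.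
  move=> injT; rewrite -(card_imset _ injT); apply: eq_card => v.
  have [c <-] := inj_ord_surj v injT card_n.
  by rewrite mem_imset // !inE.
have inj_collapse : {in B &, injective collapse}.
  move=> T T' /setIdP[/standardP[injT _] rT] /setIdP[/standardP[injT' _] rT'] eq_TT'.
  have eq_g c : g (T c) = g (T' c).
    by apply: succn_inj; rewrite -!val_collapse eq_TT'.
  apply/ffunP; apply: (order_unique injT injT' card_n) => y z lt_T'.
  have := mono_g _ _ (ltnW lt_T'); rewrite leq_eqVlt -!eq_g => /predU1P[eq_yz|lt_g].
    have := key_ltn_in_block injT' mono_g rT' lt_T'; rewrite -!eq_g => /(_ eq_yz) lt_key.
    case: (ltngtP (T y) (T z)) => // [lt_T|/ord_inj/injT eq_y].
      by have := key_ltn_in_block injT mono_g rT lt_T (esym eq_yz); lia.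
    by rewrite eq_y ltnn in lt_T'.
  by rewrite ltnNge; apply: contraL lt_g => /mono_g; rewrite leqNgt.
rewrite -(card_in_imset inj_collapse); apply: eq_card => F; rewrite inE.
apply/andP/imsetP => [[RSCT_F /eqP weight_F]|[T]].
  pose T := [ffun c => lex_ord card_n (fun c => F c : nat) (@key a) c].
  have T_std : T \in standard a n := standardise_standard RSCT_F.
  have lt_T c d : (T c < T d) = lex (fun c => F c : nat) (@key a) c d.
    by rewrite !ffunE (lex_ord_ltn card_n _ _ (@lex_key_inj _)).
  have [F_gt0 _ _ _] := (RSCTP _).1 RSCT_F; have [injT _] := standardP _ T_std.
  have F_eq c : F c = (g (T c)).+1 :> nat.
    rewrite (sorted_fibres (F := fun c => (F c).-1) c injT card_n) ?prednK //.
      by move=> y z; rewrite lt_T /lex; have := F_gt0 y; have := F_gt0 z; lia.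
    move=> i; case: (ltnP i k) => [lt_ik|le_ki].
      have eq_pred (x : nat) : 0 < x -> (x.-1 == i) = (x == i.+1) by lia.
      have /mnmP/(_ (Ordinal lt_ik)) := weight_F; rewrite !mnmE /= => <-.
      by apply: eq_card => d; rewrite !inE; exact: eq_pred (F_gt0 d).
    rewrite !(eq_card (B := pred0)) ?card0 // => d; rewrite inE; apply/negbTE.
      by have := g_lt d; lia.
    have pred_lt (x : nat) : 0 < x -> x < k.+1 -> x.-1 <> i by lia.
    by apply/eqP; apply: pred_lt (F_gt0 d) (ltn_ord (F d)).
  exists T; last by apply/ffunP => c; apply: val_inj; rewrite /= val_collapse F_eq.
  rewrite inE T_std; apply/risesP => c d eq_T lt_key; rewrite -ltnS -!F_eq.
  by have := lt_T c d; rewrite eq_T ltnSn /lex; lia.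
move=> /setIdP[T_std rises] ->; split.
  by apply: eq_RSCT (collapse_RSCT T_std mono_g rises) => c; rewrite val_collapse.
apply/eqP/mnmP => i; rewrite !mnmE -(fibre_T T) ; last by case/standardP: T_std.
by apply: eq_card => c; rewrite !inE val_collapse eqSS.
Qed.
End Standardisation.

(** * Tableaux with only descents inside blocks *)

(** The statistic that orders the triangular matrix. *)
Definition choose2_sum (a : seq nat) : nat := \sum_(x <- a) 'C(x, 2).

Lemma sum_cols (a : seq nat) : \sum_(c : cell a) col_of c = choose2_sum a.
Proof.
rewrite (sum_cells a (fun _ j => j)) /choose2_sum (big_nth 0) big_mkord.
by apply: eq_bigr => i _; rewrite -bin2_sum big_mkord.
Qed.

Section Blocks.
Variables (a : seq nat) (n : nat) (T : {ffun cell a -> 'I_n}) (g : 'I_n -> nat).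
Hypothesis size_a : sumn a = n.
Hypothesis T_std : T \in standard a n.
Hypothesis mono_g : forall u v : 'I_n, u <= v -> g u <= g v.
Hypothesis descends : forall c d, T d = (T c).+1 :> nat ->
  g (T c) = g (T d) -> key d < key c.

Let card_n : #|{: cell a}| = n.
Proof. by rewrite card_cells. Qed.

Let injT : injective T.
Proof. by case/standardP: T_std. Qed.

Lemma key_gtn_in_block c d : T c < T d -> g (T c) = g (T d) -> key d < key c.
Proof.
apply: (ord_chain (r := [rel x y | key y < key x])) => //.
by move=> y x z lt_yx lt_zy; apply: ltn_trans lt_zy lt_yx.
Qed.

(** In a block the entries decrease along the reading order, and [d] is read after
[c], so [T d] is less than [T c]: the conclusion of the triple rule fails for
[c] and [d], and so must its hypothesis. *)
Lemma block_triple c d : row_of c < row_of d -> col_of d = (col_of c).+1 :> nat ->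
  g (T d) = g (T c) ->
  exists e, [/\ row_of e = row_of c :> nat, col_of e = col_of d :> nat & T d <= T e].
Proof.
move=> lt_r eq_c eq_g; have [_ /RSCTP[_ _ _ triple]] := standardP _ T_std.
case: (boolP [exists e, [&& row_of e == row_of c, col_of e == col_of d & T d <= T e]]).
  by case/existsP => e /and3P[/eqP re /eqP ce le_T]; exists e; rewrite re ce.
move/existsPn => none.
have lt_T : T c <= T d.
  apply: (triple c d) => // e re ce; rewrite ltnS ltnNge; apply/negP => le_T.
  by have /negP := none e; apply; rewrite -!val_eqE /= re ce !eqxx.
have neq_cd : T c != T d :> nat.
  by apply/eqP => /ord_inj/injT eq_cd; rewrite eq_cd in lt_r; rewrite ltnn in lt_r.
have := @key_gtn_in_block c d; rewrite ltn_neqAle neq_cd lt_T -eq_g => /(_ erefl erefl).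
by have := @key_col _ c d; rewrite eq_c ltnSn => /(_ erefl); lia.
Qed.

(** In the first column the entries increase downwards, but inside a block they should
decrease in that direction. In another column, if the upper cell [c] has the
smaller entry, the triple rule puts the left neighbour of [c] between the two
entries, hence in the same block, where it would have to exceed the entry of the
later read cell [d]; if [c] has the larger entry, the upward reading order
contradicts descent. *)
Lemma block_col_inj c d : g (T c) = g (T d) -> col_of c = col_of d :> nat -> c = d.
Proof.
wlog lt_r : c d / row_of c < row_of d => [wlog_lt|] eq_g eq_c.
  case: (ltngtP (row_of c) (row_of d)) => [lt|lt|eq_r]; last exact: cell_eq.
    exact: wlog_lt.
  by apply/esym/wlog_lt.
have neq_cd : T c <> T d :> nat.
  by move=> /ord_inj/injT eq_cd; rewrite eq_cd in lt_r; rewrite ltnn in lt_r.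
have [_ /RSCTP[_ rows col0 triple]] := standardP _ T_std.
case: (posnP (col_of c)) => [c0|c_gt0].
  have d0 : col_of d = 0 :> nat by rewrite -eq_c.
  have le_T := col0 c d c0 d0 (ltnW lt_r); rewrite ltnS in le_T.
  have lt_key := key_col0 c0 d0 lt_r.
  by have := @key_gtn_in_block c d; rewrite ltn_neqAle le_T eq_g; move/eqP: neq_cd => ->;
    move=> /(_ erefl erefl); lia.
have [b [rb cb]] : exists b : cell a,
    row_of b = row_of c :> nat /\ col_of b = (col_of c).-1 :> nat.
  apply: cell_exists; first exact: ltn_ord.
  by apply: leq_ltn_trans (leq_pred _) (col_lt c).
have lt_bc : T c < T b by apply: rows => //; rewrite cb prednK.
case: (ltngtP (T c) (T d)) => // lt_T; last first.
  by have := key_gtn_in_block lt_T (esym eq_g); have := key_colS eq_c c_gt0 lt_r; lia.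
have le_bd : T b <= T d.
  rewrite -ltnS; apply: triple; rewrite ?rb ?cb ?prednK -?eq_c // => e re ce.
  by have -> : e = c by apply: cell_eq; lia.
have lt_bd : T b < T d.
  rewrite ltn_neqAle le_bd andbT; apply/eqP => /ord_inj/injT eq_bd.
  by move: lt_r; rewrite -eq_bd rb ltnn.
have le_cb := mono_g (ltnW lt_bc); have le_gbd := mono_g le_bd.
have := key_gtn_in_block lt_bd; have := @key_col _ b d; lia.
Qed.

Lemma card_block i : #|[set c | g (T c) == i]| = #|[set v | g v == i]|.
Proof.
rewrite -(card_imset _ injT); apply: eq_card => v.
have [c <-] := inj_ord_surj v injT card_n.
by rewrite mem_imset // !inE.
Qed.

(** The cells of a block lie in distinct columns, so [sum_distinct_ge] applies to its
set of columns. *)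
Lemma sum_block_cols i :
    'C(#|[set v | g v == i]|, 2) <= \sum_(c | g (T c) == i) col_of c /\
  ('C(#|[set v | g v == i]|, 2) = \sum_(c | g (T c) == i) col_of c ->
   forall c j, g (T c) = i -> j < col_of c ->
     exists d, g (T d) = i /\ col_of d = j :> nat).
Proof.
pose P j := #|[set c | (g (T c) == i) && (col_of c == j :> nat)]|.
have P_le1 j : j < max_part a -> P j <= 1.
  move=> _; apply/card_le1_eqP => c d; rewrite !inE.
  move=> /andP[/eqP gc /eqP cc] /andP[/eqP gd /eqP cd].
  by apply: block_col_inj; rewrite ?gc ?cc.
have sum_P : \sum_(j < max_part a) P j = #|[set v | g v == i]|.
  rewrite -card_block -sum1dep_card (partition_big (@col_of a) xpredT) //=.
  by apply: eq_bigr => j _; rewrite sum1dep_card.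
have sum_Pj : \sum_(j < max_part a) P j * j = \sum_(c | g (T c) == i) col_of c.
  rewrite [RHS](partition_big (@col_of a) xpredT) //=.
  apply: eq_bigr => j _; rewrite (eq_bigr (fun=> nat_of_ord j)) ?sum_nat_cond_const //.
  by move=> c /andP[_ /eqP->].
have [ge closed] := sum_distinct_ge P_le1; rewrite sum_P sum_Pj in ge closed.
split=> // eq_i c j gc lt_j.
have /card_gt0P[d] : 0 < P j.
  apply: (closed eq_i (col_of c) j); first by rewrite lt_j ltn_ord.
  by apply/card_gt0P; exists c; rewrite inE gc !eqxx.
by rewrite inE => /andP[/eqP gd /eqP cd]; exists d.
Qed.

Variable m : nat.
Hypothesis g_lt : forall v, g v < m.

Lemma sum_cols_blocks :
  \sum_(c : cell a) col_of c = \sum_(i < m) \sum_(c | g (T c) == i) col_of c.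
Proof.
by rewrite (partition_big (fun c => Ordinal (g_lt (T c))) xpredT).
Qed.

Lemma choose2_blocks_le : \sum_(i < m) 'C(#|[set v | g v == i]|, 2) <= choose2_sum a.
Proof.
by rewrite -sum_cols sum_cols_blocks; apply: leq_sum => i _; have [] := sum_block_cols i.
Qed.

Hypothesis a_gt0 : all (leq 1) a.
Hypothesis g_onto : forall (v : 'I_n) (i : nat), i <= g v -> exists u, g u = i.

(** By equality every block occupies an initial segment of the columns. In the first
column each block occurs exactly once and the blocks increase downwards, so the
cell of row r is in block r. Then go from column j to column j + 1: the block b of
a cell [c] there is at most its row. If it were less, the cell of row b in column
j would be in block b too, and [block_triple] would provide a second cell of
block b in column j + 1, in row b, against [block_col_inj]. *)
Lemma blocks_are_rows c :
  \sum_(i < m) 'C(#|[set v | g v == i]|, 2) = choose2_sum a -> g (T c) = row_of c.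
Proof.
rewrite -sum_cols sum_cols_blocks => eq_sum.
have left_closed d j : j < col_of d ->
    exists e, g (T e) = g (T d) /\ col_of e = j :> nat.
  have leif (i : 'I_m) (_ : true) : 'C(#|[set v | g v == i]|, 2) <=
      \sum_(c | g (T c) == i) col_of c
      ?= iff ('C(#|[set v | g v == i]|, 2) == \sum_(c | g (T c) == i) col_of c).
    by split=> //; have [] := sum_block_cols i.
  have [_] := leqif_sum leif; rewrite eq_sum eqxx => /esym/forallP all_eq lt_j.
  have /eqP eq_d := all_eq (Ordinal (g_lt (T d))).
  by have [_ closed] := sum_block_cols (g (T d)); apply: (closed eq_d d j).
have [_ /RSCTP[_ rows col0 _]] := standardP _ T_std.
move: {2}(nat_of_ord (col_of c)) (erefl (nat_of_ord (col_of c))) => j.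
elim: j c => [|j IHj] c col_c.
  move: {2}(nat_of_ord (row_of c)) (erefl (nat_of_ord (row_of c))) => r.
  elim/ltn_ind: r c col_c => r IHr c col_c row_c.
  have ge_r : row_of c <= g (T c).
    rewrite leqNgt; apply/negP => lt_g.
    have [d [rd cd]] : exists d : cell a, row_of d = g (T c) :> nat /\ col_of d = 0 :> nat.
      apply: cell_exists; first exact: ltn_trans lt_g (ltn_ord _).
      by apply/(all_nthP 0 a_gt0)/(ltn_trans lt_g)/ltn_ord.
    have gd : g (T d) = row_of d by apply: (IHr (row_of d)); rewrite // rd -row_c.
    have eq_dc : d = c by apply: block_col_inj; rewrite ?gd ?cd.
    by move: lt_g; rewrite -rd eq_dc ltnn.
  apply/eqP; rewrite eqn_leq ge_r andbT leqNgt; apply/negP => lt_g.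
  have [u gu] := g_onto (ltnW lt_g).
  have [e Te] := inj_ord_surj u injT card_n; rewrite -Te in gu.
  have [d [gd cd]] : exists d : cell a, g (T d) = g (T e) /\ col_of d = 0 :> nat.
    by case: (posnP (col_of e)) => [e0|/left_closed//]; exists e.
  case: (ltnP (row_of d) (row_of c)) => [lt_r|le_r].
    have : g (T d) = row_of d by apply: (IHr (row_of d)); rewrite // -row_c.
    by rewrite gd gu => eq_r; rewrite eq_r ltnn in lt_r.
  have := mono_g (col0 c d col_c cd le_r).
  by rewrite gd gu leqNgt lt_g.
have [b [rb cb]] : exists b : cell a, row_of b = row_of c :> nat /\ col_of b = j :> nat.
  apply: cell_exists; first exact: ltn_ord.
  by apply: ltn_trans (col_lt c); rewrite col_c.
have le_g : g (T c) <= row_of c.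
  by rewrite -rb -IHj //; apply/mono_g/ltnW/rows; rewrite // cb col_c.
apply/eqP; move: le_g; rewrite leq_eqVlt => /orP[//|lt_g].
have [d [gd cd]] : exists d : cell a, g (T d) = g (T c) /\ col_of d = j :> nat.
  by apply: left_closed; rewrite col_c.
have rd := IHj d cd.
have [|||e [re ce le_T]] := @block_triple d c; rewrite -?rd ?gd ?cd //.
have lt_ed : T e < T d by apply: rows; rewrite // ce cd col_c.
have le_ed := mono_g (ltnW lt_ed); have le_ce := mono_g le_T.
have eq_ec : e = c by apply: block_col_inj => //; lia.
by rewrite -eq_ec re -rd gd eq_ec eqxx.
Qed.
End Blocks.

(** The opposite extreme to [rises_at_descents]: for [g = cuts S] it says that the
descent set contains the complement of [S]. *)
Definition descends_in_blocks (a : seq nat) (n : nat) (g : 'I_n -> nat)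
    (T : cell a -> 'I_n) : bool :=
  [forall c, forall d,
     (T d == (T c).+1 :> nat) && (g (T c) == g (T d)) ==> (key d < key c)].

Lemma descendsP (a : seq nat) (n : nat) (g : 'I_n -> nat) (T : cell a -> 'I_n) :
  reflect (forall c d, T d = (T c).+1 :> nat -> g (T c) = g (T d) -> key d < key c)
    (descends_in_blocks g T).
Proof.
apply: (iffP 'forall_forallP) => [desc c d eq_T eq_g|desc c d].
  by have /implyP := desc c d; apply; rewrite eq_T eq_g !eqxx.
by apply/implyP => /andP[/eqP eq_T /eqP]; apply: desc.
Qed.

(** The only tableau fills the rows from top to bottom with consecutive entries, each
row from right to left. *)
Lemma card_row_blocks (a : seq nat) (n : nat) (g : 'I_n -> nat) :
    sumn a = n -> all (leq 1) a -> (forall u v : 'I_n, u <= v -> g u <= g v) ->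
    (forall v, g v < size a) ->
    (forall (v : 'I_n) (i : nat), i <= g v -> exists u, g u = i) ->
    (forall i, #|[set v | g v == i]| = nth 0 a i) ->
  #|[set T in standard a n | descends_in_blocks g T]| = 1.
Proof.
move=> size_a a_gt0 mono_g g_lt g_onto fibre_g.
have card_n : #|{: cell a}| = n by rewrite card_cells.
pose row c : nat := row_of (c : cell a).
pose neg_col c := max_part a - col_of (c : cell a).
have row_inj c d : row c = row d -> neg_col c = neg_col d -> c = d.
  move=> eq_r; have := ltn_ord (col_of c); have := ltn_ord (col_of d).
  by rewrite /neg_col => lt_c lt_d eq_c; apply: cell_eq; rewrite //; lia.
(* The first key orders the rows, the second one runs from right to left. *)
pose T0 := [ffun c => lex_ord card_n row neg_col c].
have T0_lt c d : (T0 c < T0 d) = lex row neg_col c d.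
  by rewrite !ffunE (lex_ord_ltn card_n _ _ row_inj).
have T0_inj : injective T0 by move=> c d; rewrite !ffunE; apply: lex_ord_inj.
have neg_col_lt c d : (neg_col c < neg_col d) = (col_of d < col_of c).
  by have := ltn_ord (col_of c); have := ltn_ord (col_of d); rewrite /neg_col; lia.
have T0_std : T0 \in standard a n.
  apply/standardP; split=> //; apply/RSCTP.
  split=> [//|c d eq_r lt_c|c d c0 d0|c d lt_r _ _]; rewrite ltnS.
  - by rewrite T0_lt /lex /row eq_r neg_col_lt lt_c eqxx orbT.
  - rewrite leq_eqVlt => /predU1P[eq_r|lt_r].
      by have -> : c = d by apply: cell_eq; rewrite ?c0.
    by rewrite ltnW // T0_lt /lex lt_r.
  by rewrite ltnW // T0_lt /lex /row lt_r.
have g_T0 c : g (T0 c) = row c.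
  apply: (sorted_fibres c T0_inj card_n _ mono_g) => // [y z lt_r|i].
    by rewrite T0_lt /lex lt_r.
  by rewrite fibre_g -card_row.
apply/eqP/cards1P; exists T0; apply/setP => T.
apply/setIdP/set1P => [[T_std /descendsP desc]|->].
  have [injT /RSCTP[_ rows _ _]] := standardP _ T_std.
  have g_T c : g (T c) = row c.
    apply: (blocks_are_rows size_a T_std mono_g desc g_lt a_gt0 g_onto).
    rewrite /choose2_sum [RHS](big_nth 0) big_mkord.
    by apply: eq_bigr => i _; rewrite fibre_g.
  apply/esym/ffunP; apply: (order_unique T0_inj injT card_n) => y z lt_T.
  rewrite T0_lt /lex -!g_T neg_col_lt.
  have := mono_g _ _ (ltnW lt_T); rewrite leq_eqVlt => /predU1P[eq_g|->//].
  rewrite eq_g eqxx orbC /= ; case: (ltngtP (col_of z) (col_of y)) => // [lt_c|eq_c].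
    by have := rows y z; rewrite -/(row y) -/(row z) -!g_T ltnS => /(_ eq_g lt_c); lia.
  have eq_yz : y = z by apply: cell_eq; rewrite // -/(row y) -/(row z) -!g_T.
  by rewrite eq_yz ltnn in lt_T.
split=> //; apply/descendsP => c d eq_T; rewrite !g_T0 => eq_r; apply: key_col.
by have := T0_lt c d; rewrite eq_T ltnSn /lex neg_col_lt eq_r ltnn eqxx.
Qed.

(** * Cut sets, compositions and descent sets *)

(** The index of the block containing [v] when {0, ..., n - 1} is cut between [u] and
[u + 1] for each [u] in [S]. *)
Definition cuts (n : nat) (S : {set 'I_n.-1}) (v : nat) : nat :=
  \sum_(u in S) (u < v).

Definition block_sizes (n : nat) (S : {set 'I_n.-1}) : seq nat :=
  mkseq (fun i => #|[set v : 'I_n | cuts S v == i]|) #|S|.+1.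

Lemma eq_positive_seq (a b : seq nat) : all (leq 1) a -> all (leq 1) b ->
  (forall i, nth 0 a i = nth 0 b i) -> a = b.
Proof.
move=> /(all_nthP 0) a_gt0 /(all_nthP 0) b_gt0 eq_ab.
apply: (eq_from_nth (x0 := 0)) => [|i _]; last exact: eq_ab.
case: (ltngtP (size a) (size b)) => // lt_size.
  by have := b_gt0 _ lt_size; rewrite -eq_ab nth_default.
by have := a_gt0 _ lt_size; rewrite eq_ab nth_default.
Qed.

Section Cuts.
Variable n : nat.
Implicit Types (S : {set 'I_n.-1}) (v : nat).

Lemma cuts0 S : cuts S 0 = 0.
Proof. by rewrite /cuts big1. Qed.

Lemma cutsS S (v : 'I_n.-1) : cuts S v.+1 = cuts S v + (v \in S).
Proof.
rewrite /cuts (eq_bigr (fun u : 'I_n.-1 => (u < v) + (u == v))); last first.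
  by move=> u _; rewrite -val_eqE /= ltnS leq_eqVlt; case: ltngtP.
rewrite big_split /=; congr (_ + _); case: (boolP (v \in S)) => [vS|vS].
  by rewrite (bigD1 v) //= eqxx big1 // => u /andP[_ /negbTE->].
by rewrite big1 // => u uS; case: eqP vS => // <-; rewrite uS.
Qed.

Lemma cuts_mono S v w : v <= w -> cuts S v <= cuts S w.
Proof.
move=> le_vw; apply: leq_sum => u _.
by case: (ltnP u v) => // lt_uv; rewrite (leq_trans lt_uv).
Qed.

Lemma cuts_le_card S v : cuts S v <= #|S|.
Proof. by rewrite -sum1_card; apply: leq_sum => u _; apply: leq_b1. Qed.

Lemma cuts_last S : cuts S n.-1 = #|S|.
Proof. by rewrite -sum1_card; apply: eq_bigr => u _; rewrite ltn_ord. Qed.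

Lemma card_cuts_le S : #|S| <= n.-1.
Proof. by rewrite -[leqRHS]card_ord max_card. Qed.

Lemma cuts_lt S v : 0 < n -> cuts S v < n.
Proof. by have := cuts_le_card S v; have := card_cuts_le S; lia. Qed.

(** The block index starts at 0 and grows by steps of at most one, so it skips no
value. *)
Lemma cuts_onto S w i : w < n -> i <= cuts S w -> exists u : 'I_n, cuts S u = i.
Proof.
elim: w => [|w IHw] lt_w.
  by rewrite cuts0 leqn0 => /eqP->; exists (Ordinal lt_w); rewrite /= cuts0.
have lt_w1 : w < n.-1 by lia.
have := cutsS S (Ordinal lt_w1); rewrite /= => def_w1 le_i.
case: (leqP i (cuts S w)) => [|lt_i]; first by apply: IHw; lia.
by exists (Ordinal lt_w); move: le_i; rewrite /= def_w1; case: (_ \in _); lia.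
Qed.

Lemma nth_block_sizes S i : nth 0 (block_sizes S) i = #|[set v : 'I_n | cuts S v == i]|.
Proof.
case: (ltnP i #|S|.+1) => [lt_i|le_i]; first by rewrite nth_mkseq.
rewrite nth_default ?size_mkseq //; apply/esym/eqP; rewrite cards_eq0.
by apply/eqP/setP => v; rewrite !inE ltn_eqF // (leq_ltn_trans (cuts_le_card S v)).
Qed.

Lemma cuts_lt_size S v : cuts S v < size (block_sizes S).
Proof. by rewrite size_mkseq ltnS cuts_le_card. Qed.

Lemma cuts_inj S S' :
  (forall v : 'I_n, cuts S v = cuts S' v) -> S = S'.
Proof.
move=> eq_cuts; apply/setP => v; have lt_v := ltn_ord v.
have lt_v0 : v < n by lia.
have lt_v1 : v.+1 < n by lia.
have := cutsS S v; rewrite (eq_cuts (Ordinal lt_v1)) (eq_cuts (Ordinal lt_v0)) /= cutsS.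
by move/addnI; case: (v \in S); case: (v \in S').
Qed.

Lemma block_sizes_inj : injective (@block_sizes n).
Proof.
move=> S S' eq_b; apply: cuts_inj => v.
apply: (sorted_fibres (T := id) (F := fun v : 'I_n => cuts S' v)
  (g := fun v : 'I_n => cuts S v) v (@inj_id _) (card_ord n)).
- by move=> y z; rewrite !ltnNge; apply: contra; apply: cuts_mono.
- by move=> y z; apply: cuts_mono.
by move=> i; rewrite -!nth_block_sizes eq_b.
Qed.

Hypothesis n_gt0 : 0 < n.

Lemma block_sizes_composition S : is_composition n (block_sizes S).
Proof.
apply/andP; split.
  apply/(all_nthP 0) => i; rewrite size_mkseq ltnS nth_block_sizes -(cuts_last S) => le_i.
  have [|u eq_u] := @cuts_onto S n.-1 i _ le_i; first by rewrite prednK.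
  by apply/card_gt0P; exists u; rewrite inE eq_u.
rewrite sumnE (big_nth 0) big_mkord -[X in _ == X]card_ord -sum1_card.
rewrite (partition_big (fun v : 'I_n => Ordinal (cuts_lt_size S v)) xpredT) //=.
apply/eqP/eq_bigr => i _; rewrite nth_block_sizes -sum1dep_card.
by apply: eq_bigl => v; rewrite -val_eqE.
Qed.

(** The block index is rebuilt as the weakly increasing word [w] in which the letter i
occurs as often as the i-th part says; [S] is the set of ascents of [w]. *)
Lemma block_sizes_onto a : is_composition n a -> exists S, block_sizes S = a.
Proof.
case/andP => a_gt0 /eqP size_a.
pose w := sort leq (flatten [seq nseq (nth 0 a i) i | i <- iota 0 (size a)]).
have count_w i : count_mem i w = nth 0 a i.
  rewrite count_sort count_flatten -map_comp sumnE big_map -{1}[size a]subn0.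
  rewrite big_mkord (eq_bigr (fun j : 'I__ => if j == i :> nat then nth 0 a j else 0)).
    case: (ltnP i (size a)) => [lt_i|le_i].
      rewrite (bigD1 (Ordinal lt_i)) //= eqxx big1 ?addn0 // => j.
      by rewrite -val_eqE /= => /negbTE->.
    rewrite nth_default // big1 // => j _; rewrite ltn_eqF //.
    exact: leq_trans le_i.
  by move=> j _; rewrite /= count_nseq; case: eqP => [->|]; rewrite /= ?eqxx; lia.
have size_w : size w = n.
  rewrite size_sort size_flatten /shape -map_comp -size_a.
  rewrite (eq_map (g := nth 0 a)) ?map_nth_iota0 ?take_size // => j.
  by rewrite /= size_nseq.
have nth_w_mono u v : u <= v -> v < n -> nth 0 w u <= nth 0 w v.
  rewrite -size_w => le_uv lt_v; apply: (sorted_leq_nth leq_trans leqnn) => //.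
    exact: sort_sorted leq_total _.
  by rewrite inE (leq_ltn_trans le_uv).
have nth_w_lt v : v < n -> nth 0 w v < size a.
  rewrite -size_w => /(mem_nth 0); rewrite -has_pred1 has_count count_w => nth_gt0.
  by rewrite ltnNge; apply: contraL nth_gt0 => le_a; rewrite nth_default.
have w_onto i : i < size a -> exists u, u < n /\ nth 0 w u = i.
  move/(all_nthP 0 a_gt0); rewrite -count_w -has_count has_pred1 => w_i.
  by exists (index i w); rewrite -size_w index_mem nth_index.
pose S := [set v : 'I_n.-1 | nth 0 w v < nth 0 w v.+1].
have cuts_w v : v < n -> cuts S v = nth 0 w v.
  elim: v => [_|v IHv lt_v].
    rewrite cuts0; have [|u [lt_u w_u]] := w_onto 0.
      by move: size_a n_gt0; case: (a) => //= <-.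
    by have := nth_w_mono 0 u; rewrite w_u; lia.
  have lt_v1 : v < n.-1 by lia.
  rewrite (cutsS S (Ordinal lt_v1)) /= IHv ?inE /=; last by lia.
  have := nth_w_mono v v.+1 (leqnSn v) lt_v.
  (* A jump by two or more would miss a letter that occurs somewhere in [w]. *)
  case: (leqP (nth 0 w v.+1) (nth 0 w v).+1) => [|gap]; first by lia.
  have lt_x : (nth 0 w v).+1 < size a by apply: ltn_trans gap (nth_w_lt _ lt_v).
  have [u [lt_u w_u]] := w_onto _ lt_x.
  case: (leqP u v) => [le_uv|lt_vu].
    by have := nth_w_mono u v le_uv (ltnW lt_v); rewrite w_u ltnn.
  by have := nth_w_mono v.+1 u lt_vu lt_u; rewrite w_u leqNgt gap.
exists S; apply: eq_positive_seq => // [|i].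
  by case/andP: (block_sizes_composition S).
rewrite nth_block_sizes -count_w -sum1_count (big_nth 0) size_w big_mkord -sum1dep_card.
by apply: eq_bigl => v; rewrite cuts_w.
Qed.

End Cuts.

Definition descent_set (a : seq nat) (n : nat) (T : cell a -> 'I_n) : {set 'I_n.-1} :=
  [set v : 'I_n.-1 | [exists c : cell a, exists d : cell a,
     [&& T c == v :> nat, T d == v.+1 :> nat & key d < key c]]].

Section Descents.
Variables (a : seq nat) (n : nat) (T : {ffun cell a -> 'I_n}).
Hypotheses (size_a : sumn a = n) (T_std : T \in standard a n).

Let injT : injective T.
Proof. by case/standardP: T_std. Qed.

Lemma mem_descent_set (v : 'I_n.-1) c d : T c = v :> nat -> T d = v.+1 :> nat ->
  (v \in descent_set T) = (key d < key c).
Proof.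
move=> Tc Td; rewrite inE; apply/existsP/idP => [[c' /existsP[d' /and3P[]]]|lt_key].
  by rewrite -Td -Tc => /eqP/ord_inj/injT-> /eqP/ord_inj/injT->.
by exists c; apply/existsP; exists d; rewrite Tc Td !eqxx.
Qed.

Lemma consecutive_cells (v : 'I_n.-1) :
  exists c d, T c = v :> nat /\ T d = v.+1 :> nat.
Proof.
have card_n : #|{: cell a}| = n by rewrite card_cells.
have lt_v := ltn_ord v.
have lt_v0 : v < n by lia.
have lt_v1 : v.+1 < n by lia.
have [c Tc] := inj_ord_surj (Ordinal lt_v0) injT card_n.
have [d Td] := inj_ord_surj (Ordinal lt_v1) injT card_n.
by exists c, d; rewrite Tc Td.
Qed.

Lemma rises_cutsE S :
  rises_at_descents (fun v => cuts S v) T = (descent_set T \subset S).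
Proof.
apply/risesP/subsetP => [rises v|sub_S c d eq_T lt_key].
  have [c [d [Tc Td]]] := consecutive_cells v.
  rewrite (mem_descent_set Tc Td) => /(rises c d).
  rewrite Td Tc cutsS => /(_ erefl); case: (v \in S) => //. by rewrite addn0 ltnn.
have lt_c : T c < n.-1 by have := ltn_ord (T d); lia.
have : Ordinal lt_c \in S by apply/sub_S; rewrite (@mem_descent_set _ c d).
by rewrite eq_T (cutsS S (Ordinal lt_c)) => ->; rewrite addn1.
Qed.

Lemma descends_cutsE S :
  descends_in_blocks (fun v => cuts S v) T = (~: S \subset descent_set T).
Proof.
apply/descendsP/subsetP => [desc v|sub_S c d eq_T eq_cuts].
  have [c [d [Tc Td]]] := consecutive_cells v.
  rewrite (mem_descent_set Tc Td) inE => vS; apply: desc; first by rewrite Tc.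
  by rewrite Td Tc cutsS (negbTE vS) addn0.
have lt_c : T c < n.-1 by have := ltn_ord (T d); lia.
rewrite -(@mem_descent_set (Ordinal lt_c) c d) //; apply: sub_S; rewrite inE.
move: eq_cuts; rewrite eq_T (cutsS S (Ordinal lt_c)) /=.
by case: (_ \in S) => //; rewrite addn1 => /n_Sn.
Qed.

End Descents.

(** * Inclusion-exclusion on coefficients *)

Definition cut_mon (k n : nat) (S : {set 'I_n.-1}) : 'X_{1..k} :=
  fibre_mon k (fun v : 'I_n => cuts S v).

(** The Moebius transform, on the Boolean lattice, of the coefficients at the monomials
[cut_mon]. Complements are used because the coefficient of RS_a at [~: S] counts
the tableaux that have no descent in [S]. *)
Definition signed_coef (k n : nat) (U : {set 'I_n.-1}) (p : {mpoly int[k]}) : int :=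
  (\sum_(S : {set 'I_n.-1} | S \subset U) (-1) ^+ #|S| * p@_(cut_mon k (~: S)))%R.

(** The condition on [D] says that [S] is disjoint from it, so this is the expansion of
the product of 1 - [i in A but not in D] over all i, which vanishes as soon as
one such i exists. *)
Lemma alternating_sum (I : finType) (A D : {set I}) :
  (\sum_(S : {set I} | S \subset A) (-1) ^+ #|S| * (D \subset ~: S)%:R =
   (A \subset D)%:R :> int)%R.
Proof.
have sub_set0 (B : {set I}) : (\prod_i (- (i \in B)%:R + 1) = (B == set0)%:R :> int)%R.
  have [->|[x xB]] := set_0Vmem B.
    by rewrite eqxx big1 // => i _; rewrite inE oppr0 add0r.
  by rewrite (bigD1 x) //= xB addNr mul0r; case: eqP xB => // ->; rewrite inE.
rewrite -setD_eq0 -sub_set0 bigA_distr big_mkcond /=.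
apply: eq_bigr => S _; rewrite [RHS](bigID (mem S)) /= [X in (_ = _ * X)%R]big1 ?mulr1;
  last first.
  by move=> i /negbTE->.
rewrite (eq_bigr (fun i => - (i \in A :\: D)%:R)%R); last by move=> i ->.
have sub_AD : (S \subset A :\: D) = (S \subset A) && (D \subset ~: S).
  by rewrite subsetD -disjoints_subset disjoint_sym.
case: (boolP (S \subset A :\: D)) => [sub_S|not_sub].
  have /andP[-> ->] : (S \subset A) && (D \subset ~: S) by rewrite -sub_AD.
  rewrite mulr1 (eq_bigr (fun=> (-1)%R)) ?prodr_const // => i.
  by rewrite /= => /(subsetP sub_S)->.
have /subsetPn[x xS xAD] := not_sub.
rewrite [RHS](bigD1 x) //= (negbTE xAD) oppr0 mul0r.
by move: not_sub; rewrite sub_AD; case: ifP => //= _ /negbTE->; rewrite mulr0.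
Qed.

Section QSym.
Variables (n k : nat).
Hypotheses (n_gt0 : 0 < n) (le_nk : n <= k).
Implicit Types (S U : {set 'I_n.-1}) (p q : {mpoly int[k]}) (a : seq nat).

Lemma signed_coefB U p q : (signed_coef U (p - q) = signed_coef U p - signed_coef U q)%R.
Proof.
rewrite /signed_coef -sumrB; apply: eq_bigr => S _.
by rewrite mcoeffB mulrBr.
Qed.

Lemma signed_coef_sum U (I : Type) (s : seq I) (c : I -> int) (q : I -> {mpoly int[k]}) :
  (signed_coef U (\sum_(i <- s) c i *: q i) = \sum_(i <- s) c i * signed_coef U (q i))%R.
Proof.
rewrite /signed_coef; under [RHS]eq_bigr do rewrite mulr_sumr.
rewrite exchange_big; apply: eq_bigr => S _ /=.
rewrite raddf_sum /= mulr_sumr; apply: eq_bigr => i _.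
by rewrite mcoeffZ mulrCA.
Qed.

(** There are at most [n] blocks, so [n <= k] leaves a variable for each of them. *)
Lemma coef_RS_cuts a S : sumn a = n ->
  ((RS k a)@_(cut_mon k S) = #|[set T in standard a n | descent_set T \subset S]|%:R)%R.
Proof.
move=> size_a; rewrite coef_RS // => [|u v|v].
- congr (_ %:R)%R; apply: eq_card => T.
  by apply/setIdP/setIdP => -[T_std]; rewrite (rises_cutsE size_a T_std).
- exact: cuts_mono.
by apply: leq_trans le_nk; apply: cuts_lt.
Qed.

Lemma signed_coef_RS a U : sumn a = n ->
  (signed_coef U (RS k a) = #|[set T in standard a n | U \subset descent_set T]|%:R)%R.
Proof.
move=> size_a; rewrite /signed_coef.
rewrite (eq_bigr (fun S => \sum_(T in standard a n)
    (-1) ^+ #|S| * (descent_set T \subset ~: S)%:R)%R); last first.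
  move=> S _; rewrite coef_RS_cuts // -mulr_sumr; congr (_ * _)%R.
  rewrite -sum1dep_card natr_sum big_mkcondr /=.
  by apply: eq_bigr => T _; case: ifP.
rewrite exchange_big /= -sum1dep_card natr_sum big_mkcondr /=.
by apply: eq_bigr => T _; rewrite alternating_sum; case: ifP.
Qed.

(** By induction on the size of the complement: the term [S = U] of [signed_coef U]
has coefficient 1 or -1, and every other term belongs to a smaller set. *)
Lemma signed_coef_eq0 p :
  (forall U, signed_coef U p = 0%R) -> forall S, (p@_(cut_mon k S) = 0)%R.
Proof.
move=> eq0 S; rewrite -(setCK S); move: (~: S) => {}S.
move: {2}#|S| (erefl #|S|) => b; elim/ltn_ind: b S => b IHb S card_S.
have := eq0 S; rewrite /signed_coef (bigD1 S) //= big1 ?addr0 => [|S' /andP[sub_S' neq_S']].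
  by move/eqP; rewrite mulf_eq0 signr_eq0 => /eqP.
rewrite (IHb #|S'|) ?mulr0 // -card_S; apply: proper_card.
by rewrite properEneq neq_S'.
Qed.

Lemma choose2_sum_block_sizes S :
  choose2_sum (block_sizes S) = \sum_(i < #|S|.+1) 'C(#|[set v : 'I_n | cuts S v == i]|, 2).
Proof.
rewrite /choose2_sum (big_nth 0) size_mkseq big_mkord.
by apply: eq_bigr => i _; rewrite nth_block_sizes.
Qed.

Lemma signed_coef_RS_blocks a S : sumn a = n ->
  (signed_coef (~: S) (RS k a) =
   #|[set T in standard a n | descends_in_blocks (fun v => cuts S v) T]|%:R)%R.
Proof.
move=> size_a; rewrite signed_coef_RS //; congr (_ %:R)%R.
apply: eq_card => T; apply/setIdP/setIdP => -[T_std];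
  by rewrite (descends_cutsE size_a T_std).
Qed.

(** The strictly triangular part: nonzero entries off the diagonal only occur below
it, in the order by [choose2_sum]. *)
Lemma signed_coef_RS_neq0 S a : is_composition n a -> signed_coef (~: S) (RS k a) != 0%R ->
  choose2_sum (block_sizes S) < choose2_sum a \/ block_sizes S = a.
Proof.
case/andP=> a_gt0 /eqP size_a; rewrite signed_coef_RS_blocks //.
set B := [set T in _ | _]; have [->|[T]] := set_0Vmem B; first by rewrite cards0 eqxx.
case/setIdP => T_std /descendsP desc _; pose g (v : 'I_n) := cuts S v.
have mono_g (u v : 'I_n) : u <= v -> g u <= g v by apply: cuts_mono.
have g_lt v : g v < #|S|.+1 by rewrite ltnS; apply: cuts_le_card.
have g_onto (v : 'I_n) i : i <= g v -> exists u, g u = i by apply: cuts_onto (ltn_ord v).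
have := choose2_blocks_le size_a T_std mono_g desc g_lt.
rewrite leq_eqVlt choose2_sum_block_sizes => /predU1P[eq_sum|]; [right|by left].
have [b_gt0 _] := andP (block_sizes_composition n_gt0 S).
apply: eq_positive_seq => // i; rewrite nth_block_sizes // -card_row.
rewrite -(card_block g size_a T_std); apply: eq_card => c; rewrite !inE.
by rewrite (blocks_are_rows size_a T_std mono_g desc g_lt a_gt0 g_onto).
Qed.

Lemma signed_coef_RS_diag S : signed_coef (~: S) (RS k (block_sizes S)) = 1%R.
Proof.
have /andP[b_gt0 /eqP size_b] := block_sizes_composition n_gt0 S.
rewrite signed_coef_RS_blocks // card_row_blocks // => [u v|v|v i|i].
- exact: cuts_mono.
- exact: cuts_lt_size.
- exact: cuts_onto (ltn_ord v).
by rewrite nth_block_sizes.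
Qed.

Lemma place_monE S (f : 'I_(size (block_sizes S)) -> 'I_k) (h : 'I_n -> nat) :
    (forall v : 'I_n, h v = f (Ordinal (cuts_lt_size S v))) ->
  place_mon f = fibre_mon k h.
Proof.
move=> def_h; apply/mnmP => i; rewrite !mnmE -sum1dep_card.
rewrite [RHS](partition_big (fun v : 'I_n => Ordinal (cuts_lt_size S v))
  (fun j => f j == i)) /=; last by move=> v; rewrite def_h.
apply: eq_bigr => j /eqP fj; rewrite nth_block_sizes // -sum1dep_card.
apply: eq_bigl => v; rewrite def_h -val_eqE /= andbC; case: eqP => //= eq_j.
by rewrite -(_ : j = Ordinal (cuts_lt_size S v)) ?fj ?eqxx //; apply: val_inj.
Qed.

Lemma place_mon_widen S (le_bk : size (block_sizes S) <= k) :
  place_mon (widen_ord le_bk) = cut_mon k S.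
Proof. exact: place_monE. Qed.

(** A strictly increasing choice [f] of variables does not change where the block
labelling rises, and by [coef_RS] the coefficient only depends on that. *)
Lemma coef_RS_place a S (f : 'I_(size (block_sizes S)) -> 'I_k) : sumn a = n ->
    (forall i j : 'I_(size (block_sizes S)), i < j -> f i < f j) ->
  ((RS k a)@_(place_mon f) = (RS k a)@_(cut_mon k S))%R.
Proof.
move=> size_a f_inc.
pose h (v : 'I_n) : nat := f (Ordinal (cuts_lt_size S v)).
have h_lt u v : (h u < h v) = (cuts S u < cuts S v).
  case: (ltngtP (cuts S u) (cuts S v)) => [lt|lt|eq_uv].
  - exact: f_inc.
  - by rewrite ltnNge ltnW //; apply: f_inc.
  by rewrite /h (_ : Ordinal _ = Ordinal (cuts_lt_size S v)) ?ltnn //; apply: val_inj.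
have h_mono (u v : 'I_n) : u <= v -> h u <= h v.
  by move=> le_uv; rewrite leqNgt h_lt -leqNgt; apply: cuts_mono.
rewrite (place_monE (h := h)) // coef_RS //; last by move=> v; apply: ltn_ord.
rewrite coef_RS_cuts //; congr (_ %:R)%R; apply: eq_card => T.
apply/setIdP/setIdP => -[T_std]; rewrite -(rises_cutsE size_a T_std) => /risesP rises;
  by split=> //; apply/risesP => c d eq_T lt_key; have := rises c d eq_T lt_key; rewrite h_lt.
Qed.

Lemma RS_homog a : sumn a = n -> (RS k a \is n.-homog)%R.
Proof.
move=> size_a; apply: rpred_sum => F /RSCTP[F_gt0 _ _ _].
have pred_lt c : (F c).-1 < k by have := ltn_ord (F c); rewrite ltnS -ltnS prednK.
rewrite dhomogX /= mdegE -[X in _ == X]size_a -card_cells -sum1_card.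
rewrite (partition_big (fun c => Ordinal (pred_lt c)) xpredT) //=.
apply/eqP/eq_bigr => i _; rewrite mnmE -sum1dep_card; apply: eq_bigl => c.
by rewrite -val_eqE /= -[in LHS](prednK (F_gt0 c)).
Qed.

Lemma mdeg_place_mon a (f : 'I_(size a) -> 'I_k) : mdeg (place_mon f) = sumn a.
Proof.
rewrite mdegE sumnE (big_nth 0) big_mkord (partition_big f xpredT) //=.
by apply: eq_bigr => i _; rewrite mnmE.
Qed.

Lemma RS_QSym a : is_composition n a -> QSym n (RS k a).
Proof.
case/andP=> a_gt0 /eqP size_a; split; last exact: RS_homog.
move=> b le_bk f b_gt0 f_inc.
case: (sumn b =P n) => [size_b|/eqP neq_b]; last first.
  by rewrite !(dhomog_nemf_coeff (RS_homog size_a)) //= mdeg_place_mon.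
have [|S def_b] := @block_sizes_onto n n_gt0 b.
  by rewrite /is_composition b_gt0 size_b eqxx.
move: le_bk f f_inc; rewrite -def_b => le_bk f f_inc.
by rewrite coef_RS_place // coef_RS_place.
Qed.

(** The nonzero exponents, in the order of the variables, with their positions. *)
Lemma mnm_place (m : 'X_{1..k}) : exists (a : seq nat) (f : 'I_(size a) -> 'I_k),
  [/\ size a <= k, all (leq 1) a,
      forall i j : 'I_(size a), i < j -> f i < f j & m = place_mon f].
Proof.
pose s := [seq i <- enum 'I_k | m i != 0]; pose a := [seq m i | i <- s].
have size_s : size a = size s by rewrite size_map.
pose f (j : 'I_(size a)) := tnth (in_tuple s) (cast_ord size_s j).
have s_uniq : uniq s by rewrite filter_uniq ?enum_uniq.
have f_nth x0 j : f j = nth x0 s j by rewrite /f (tnth_nth x0).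
have f_inj : injective f.
  move=> i j; rewrite (f_nth (f i)) (f_nth (f i) j) => /eqP.
  by rewrite nth_uniq ?s_uniq -?size_s // => /eqP/ord_inj.
exists a, f; split.
- rewrite size_s (leq_trans (size_subseq (filter_subseq _ _))) //.
  by rewrite size_enum_ord.
- apply/allP => x /mapP[i i_s ->]; rewrite lt0n.
  by move: i_s; rewrite mem_filter => /andP[].
- move=> i j lt_ij; have x0 := f i; rewrite !(f_nth x0).
  have s_sorted : sorted (relpre val ltn) s.
    apply: sorted_filter => [y x z|]; first exact: ltn_trans.
    by rewrite -sorted_map val_enum_ord iota_ltn_sorted.
  apply: (sorted_ltn_nth _ _ s_sorted) => [y x z|||//]; first exact: ltn_trans.
  + by rewrite inE -size_s.
  + by rewrite inE -size_s.
apply/mnmP => i; rewrite mnmE.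
have nth_a (j : 'I_(size a)) : nth 0 a j = m (f j).
  by rewrite (nth_map (f j)) -?size_s // -f_nth.
case: (eqVneq (m i) 0) => [m_i|m_i].
  by rewrite big1 // => j /eqP fj; rewrite nth_a fj.
have i_s : i \in s by rewrite mem_filter m_i mem_enum.
have lt_j : index i s < size a by rewrite size_s index_mem.
have f_j : f (Ordinal lt_j) = i by rewrite (f_nth i) nth_index.
rewrite (big_pred1 (Ordinal lt_j)) => [|j]; first by rewrite nth_a f_j.
by rewrite /= -{1}f_j (inj_eq f_inj).
Qed.

(** Quasisymmetry moves any monomial of degree [n] to the first variables, where its
exponents form a composition of [n], that is the block sizes of some cut set. *)
Lemma QSym_eq0 p : QSym n p -> (forall S, (p@_(cut_mon k S) = 0)%R) -> p = 0%R.
Proof.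
case=> p_qsym p_homog p_cut0; apply/mpolyP => m; rewrite mcoeff0.
case: (mdeg m =P n) => [mdeg_m|/eqP]; last exact: dhomog_nemf_coeff.
have [a [f [le_ak a_gt0 f_inc def_m]]] := mnm_place m.
have [|S def_a] := @block_sizes_onto n n_gt0 a.
  by rewrite /is_composition a_gt0 -mdeg_m def_m mdeg_place_mon eqxx.
move: le_ak a_gt0 f f_inc def_m; rewrite -def_a => le_ak a_gt0 f f_inc def_m.
by rewrite def_m -(p_qsym _ le_ak) // place_mon_widen.
Qed.

Lemma QSymB_sum p (I : Type) (s : seq I) (c : I -> int) (q : I -> {mpoly int[k]}) :
  QSym n p -> (forall i, QSym n (q i)) -> QSym n (p - \sum_(i <- s) c i *: q i)%R.
Proof.
case=> p_qsym p_homog q_qsym; split.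
  move=> a le_ak f a_gt0 f_inc; rewrite !mcoeffB !raddf_sum /=.
  congr (_ + _)%R; first exact: p_qsym.
  apply: eq_bigr => i _; rewrite !mcoeffZ; congr (- (_ * _))%R.
  by have [q_i _] := q_qsym i; apply: q_i.
apply: rpredB => //; apply: rpred_sum => i _; apply: rpredZ.
by have [] := q_qsym i.
Qed.

(** Clear the functionals [signed_coef (~: S)] layer by layer, from the largest value
of [choose2_sum] of the block sizes down: subtracting multiples of the RS of one
layer cancels that layer and leaves the layers above at zero. The integer [b] is
a level from which on everything has been cleared. *)
Lemma RS_span p : QSym n p ->
  exists c : {set 'I_n.-1} -> int, p = (\sum_S c S *: RS k (block_sizes S))%R.
Proof.
move=> p_QSym.
pose N S := choose2_sum (block_sizes S).
have [b] : exists b, forall S, b <= N S -> signed_coef (~: S) p = 0%R.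
  exists (\max_S N S).+1 => S; by rewrite ltnNge leq_bigmax.
elim: b p p_QSym => [|b IHb] p p_QSym p0.
  exists (fun=> 0%R); rewrite big1 => [|S _]; last by rewrite scale0r.
  apply: QSym_eq0 => //; apply: signed_coef_eq0 => U.
  by rewrite -(setCK U) p0.
pose c S := (if N S == b then signed_coef (~: S) p else 0)%R.
have RS_S S : QSym n (RS k (block_sizes S)) by apply/RS_QSym/block_sizes_composition.
have [||c' def_p] := IHb (p - \sum_S c S *: RS k (block_sizes S))%R.
- exact: QSymB_sum.
- move=> S le_b; rewrite signed_coefB signed_coef_sum (bigD1 S) //= signed_coef_RS_diag mulr1.
  rewrite big1 ?addr0 => [|S' neq_S'].
    rewrite /c; case: eqP => [_|neq_b]; first by rewrite subrr.
    by rewrite p0 ?subr0 // ltn_neqAle le_b andbT eq_sym; apply/eqP.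
  rewrite /c; case: eqP => [def_b|_]; last by rewrite mul0r.
  have [->|/signed_coef_RS_neq0[||]] := eqVneq (signed_coef (~: S) (RS k (block_sizes S'))) 0%R.
  + by rewrite mulr0.
  + exact: block_sizes_composition.
  + by rewrite ltnNge -/(N S) -/(N S') def_b le_b.
  by move/block_sizes_inj => eq_S; rewrite eq_S eqxx in neq_S'.
exists (fun S => c S + c' S)%R.
under eq_bigr do rewrite scalerDl.
by rewrite big_split /= -def_p addrC subrK.
Qed.

(** By induction from the largest value of [choose2_sum] down: the functional that
belongs to [a] sees, apart from RS_a, only functions of larger [choose2_sum],
whose coefficients are already zero. *)
Lemma RS_free (s : seq (composition n)) (c : composition n -> int) : uniq s ->
  (\sum_(a <- s) c a *: RS k (val a) = 0)%R ->
  forall a : composition n, a \in s -> c a = 0%R.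
Proof.
move=> s_uniq sum0; pose N (a : composition n) := choose2_sum (val a).
pose top := \max_(a <- s) N a.
have N_le (a : composition n) : a \in s -> N a <= top.
  by move=> a_s; apply: (leq_bigmax_seq (P := xpredT) (F := N) a).
move=> a; move: {2}(top - N a) (erefl (top - N a)) => d.
elim/ltn_ind: d a => d IHd a def_d a_s.
have [S def_a] := block_sizes_onto n_gt0 (valP a).
have := signed_coef_sum (~: S) s c (fun a : composition n => RS k (val a)).
rewrite sum0 (bigD1_seq a) //= [X in _ = (_ * signed_coef _ (RS k X) + _)%R](esym def_a).
rewrite signed_coef_RS_diag mulr1 big_seq_cond big1 ?addr0 => [<-|b /andP[b_s neq_ba]].
  by rewrite /signed_coef big1 // => S' _; rewrite mcoeff0 mulr0.
have [->|/signed_coef_RS_neq0] := eqVneq (signed_coef (~: S) (RS k (val b))) 0%R.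
  by rewrite mulr0.
case/(_ (valP b)); rewrite def_a.
  move=> lt_ab; rewrite (IHd (top - N b)) ?mul0r // -def_d.
  exact: ltn_sub2l (leq_trans lt_ab (N_le b b_s)) lt_ab.
by move/val_inj => eq_ab; rewrite eq_ab eqxx in neq_ba.
Qed.
End QSym.

Theorem theorem4p1 (n k : nat) (n_ge1 : 1 <= n) (le_nk : n <= k) :
  is_basis (@QSym n k) (fun a : composition n => RS k (val a)).
Proof.
split=> [a|s c s_uniq sum0|p p_QSym].
- exact: RS_QSym (valP a).
- exact: (RS_free n_ge1 le_nk s_uniq sum0).
have [c ->] := RS_span n_ge1 le_nk p_QSym.
pose comp (S : {set 'I_n.-1}) : composition n :=
  exist _ (block_sizes S) (block_sizes_composition n_ge1 S).
have comp_inj : injective comp by move=> S S' /(congr1 val)/block_sizes_inj.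
exists [seq comp U | U : {set 'I_n.-1}], (fun a => \sum_(S | comp S == a) c S)%R.
rewrite big_image /=; apply: eq_bigr => S _.
by rewrite (big_pred1 S) // => S'; rewrite /= (inj_eq comp_inj).
Qed.
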